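(* Let the system $x_{t+1}=f(x_t,w_t)$, $y_t=h(x_t)+v_t$ be i-IOSS with functions $\beta\in\mathcal{KL}$, $\alpha_1,\alpha_2\in\mathcal K$, and let the FIE cost function satisfy Assumption A1 stated in the context. Suppose that $\beta(s,t)=\mu_1(s)\varphi_1(t)$, $\underline\rho_x(s,t)=\mu_2(s)\varphi_2(t)$ and $\rho_x(s,t)=\mu_3(s)\varphi_2(t)$, with $\mu_1,\mu_2,\mu_3\in\mathcal K$ and $\varphi_1,\varphi_2\in\mathcal L$, and that for any $\pi\in\mathcal K$ there exists $\pi'\in\mathcal K$ such that $\mu_1\left(3\mu_2^{-1}\left(\frac{\pi(s)}{\varphi_2(t)}\right)\right)\varphi_1(t)\le\pi'(s)$ for all $s,t\ge0$. Let $\eta\in(0,1)$ and $M_0,M_w,M_v\ge0$. Then there exist $\bar\beta_x\in\mathcal{KL}$ and $\bar\alpha_w,\bar\alpha_v\in\mathcal K$ satisfying the inequality of Assumption A2 stated in the context such that, with $\bar s$ the resulting constant defined in the context, the following holds: if $$\mu_1\left(3s+3\mu_2^{-1}(3\mu_3(s))\right)\varphi_1(T_{\eta,\bar s})+\alpha_1\left(3\underline\gamma_w^{-1}\left(3\mu_3(s)\varphi_2(T_{\eta,\bar s})\right)\right)+\alpha_2\left(3\underline\gamma_v^{-1}\left(3\mu_3(s)\varphi_2(T_{\eta,\bar s})\right)\right)\le\eta s$$ for all $s\in[0,\bar s]$, then $$\bar\beta_x(s,T_{\eta,\bar s})+\alpha_1\left(3\underline\gamma_w^{-1}\left(3\rho_x(s,T_{\eta,\bar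 s})\right)\right)+\alpha_2\left(3\underline\gamma_v^{-1}\left(3\rho_x(s,T_{\eta,\bar s})\right)\right)\le\eta s$$ for all $s\in[0,\bar s]$.
   Context: Notation. $\mathbb I_{\ge0}$ is the set of nonnegative integers, $\mathbb I_{a:b}$ the integers from $a$ to $b$; for discrete times, $t\ge0$ and $t\in\mathbb I_{\ge0}$ are used interchangeably; $T_{\eta,\bar s}\in\mathbb I_{\ge0}$ is a horizon size. $|\cdot|$ is the Euclidean norm. $\boldsymbol x_{a:b}$ denotes $\{x_a,\dots,x_b\}$, $h(\boldsymbol x_{a:b})=\{h(x_a),\dots,h(x_b)\}$, and $\|\boldsymbol x_{a:b}\|:=\max_{a\le i\le b}|x_i|$ if $a\le b$, $0$ if $a>b$. $\alpha:\mathbb R_{\ge0}\to\mathbb R_{\ge0}$ is a $\mathcal K$ function if continuous, zero at zero and strictly increasing, and $\mathcal K_\infty$ if moreover $\alpha(s)\to\infty$ as $s\to\infty$. $\varphi:\mathbb R_{\ge0}\to\mathbb R_{\ge0}$ is an $\mathcal L$ function if continuous, nonincreasing and $\varphi(t)\to0$ as $t\to\infty$. $\beta:\mathbb R_{\ge0}^2\to\mathbb R_{\ge0}$ is a $\mathcal{KL}$ function if $\beta(\cdot,t)\in\mathcal K$ for each $t\ge0$ and $\beta(s,\cdot)\in\mathcal L$ for each $s\ge0$. System. $x_{t+1}=f(x_t,w_t)$, $y_t=h(x_t)+v_t$, $x_t\in\mathbb R^n$, $y_t,v_t\in\mathbb R^p$, $w_t\in\mathbb R^g$, $f,h$ continuous.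 It is i-IOSS if there exist $\beta\in\mathcal{KL}$, $\alpha_1,\alpha_2\in\mathcal K$ such that for all initial states $x_0^{(1)},x_0^{(2)}$ and disturbance sequences $\boldsymbol w^{(1)}_{0:t-1},\boldsymbol w^{(2)}_{0:t-1}$, with corresponding states $x_t^{(i)}$ of $x_{t+1}=f(x_t,w_t)$, for all $t\in\mathbb I_{\ge0}$: $|x_t^{(1)}-x_t^{(2)}|\le\beta(|x_0^{(1)}-x_0^{(2)}|,t)+\alpha_1(\|\boldsymbol w^{(1)}_{0:t-1}-\boldsymbol w^{(2)}_{0:t-1}\|)+\alpha_2(\|h(\boldsymbol x^{(1)}_{0:t})-h(\boldsymbol x^{(2)}_{0:t})\|)$. Full information estimation (FIE) minimizes a cost $V_t(\chi_0-\bar x_0,\boldsymbol\omega_{0:t-1},\boldsymbol\nu_{0:t})$ over initial states $\chi_0\in\mathbb B_x^0$, disturbances $\boldsymbol\omega_{0:t-1}\in\mathbb B_w^{0:t-1}$ and noises $\boldsymbol\nu_{0:t}\in\mathbb B_v^{0:t}$ (given bounded sets) subject to $\chi_{\tau+1}=f(\chi_\tau,\omega_\tau)$ and $y_\tau=h(\chi_\tau)+\nu_\tau$; $\bar x_0$ is a prior estimate of $x_0$. Assumption A1. $V_t=V_{t,1}(\chi_0-\bar x_0)+V_{t,2}(\boldsymbol\omega_{0:t-1},\boldsymbol\nu_{0:t})$ with $V_{t,1},V_{t,2}$ continuous and, for all $\chi_0\in\mathbb B_x^0$, $\boldsymbol\omega_{0:t-1}\in\mathbb B_w^{0:t-1}$,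 $\boldsymbol\nu_{0:t}\in\mathbb B_v^{0:t}$, $t\in\mathbb I_{\ge0}$: $\underline\rho_x(|\chi_0-\bar x_0|,t)\le V_{t,1}(\chi_0-\bar x_0)\le\rho_x(|\chi_0-\bar x_0|,t)$ and $\underline\gamma_w(\|\boldsymbol\omega_{0:t-1}\|)+\underline\gamma_v(\|\boldsymbol\nu_{0:t}\|)\le V_{t,2}(\boldsymbol\omega_{0:t-1},\boldsymbol\nu_{0:t})\le\gamma_w(\|\boldsymbol\omega_{0:t-1}\|)+\gamma_v(\|\boldsymbol\nu_{0:t}\|)$, where $\underline\rho_x,\rho_x\in\mathcal{KL}$ and $\underline\gamma_w,\underline\gamma_v,\gamma_w,\gamma_v\in\mathcal K_\infty$. Assumption A2 (inequality). For all $s_x,s_w,s_v,t\ge0$: $\beta\left(s_x+\underline\rho_x^{-1}\left(\rho_x(s_x,t)+\gamma_w(s_w)+\gamma_v(s_v),t\right),t\right)\le\bar\beta_x(s_x,t)+\bar\alpha_w(s_w)+\bar\alpha_v(s_v)$, where $\underline\rho_x^{-1}(\cdot,t)$ is the inverse of $\underline\rho_x(\cdot,t)$ in its first argument at time $t$. Inverse functions and quotients are understood to be defined at the arguments at which they appear. Constant $\bar s$. $M_0,M_w,M_v$ are bounds with $|x_0-\bar x_0|\le M_0$, $|w_t|\le M_w$, $|v_t|\le M_v$ for all $t$, and $\bar s:=\beta_x(M_0,0)+\frac1{1-\eta}(\alpha_w(M_w)+\alpha_v(M_v))$ with $\beta_x(s,t)=\bar\beta_x(s,t)+\alpha_1(3\underline\gamma_w^{-1}(3\rho_x(s,t)))+\alpha_2(3\underline\gamma_v^{-1}(3\rho_x(s,t)))$,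 $\alpha_w(s)=\bar\alpha_w(s)+\alpha_1(3s+3\underline\gamma_w^{-1}(3\gamma_w(s)))+\alpha_2(3\underline\gamma_v^{-1}(3\gamma_w(s)))$, $\alpha_v(s)=\bar\alpha_v(s)+\alpha_1(3\underline\gamma_w^{-1}(3\gamma_v(s)))+\alpha_2(3s+3\underline\gamma_v^{-1}(3\gamma_v(s)))$. *)

(* Defs.v *)
From HB Require Import structures.
From mathcomp Require Import all_boot all_order all_algebra.
From mathcomp Require Import all_classical all_reals all_analysis.

Set Implicit Arguments.
Unset Strict Implicit.
Unset Printing Implicit Defensive.
Import Order.TTheory GRing.Theory Num.Theory.
Import numFieldNormedType.Exports.
Local Open Scope classical_set_scope.
Local Open Scope ring_scope.

(* A function on [0, +oo[ is a total function R -> R, of which only the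
   restriction to [0, +oo[ is constrained or used. *)

Section Comparison.
Variable R : realType.
Implicit Types (f : R -> R) (b : R -> R -> R).

Definition nonneg_reals : set R := `[0, +oo[.

Definition class_K f : Prop :=
  [/\ forall s : R, 0 <= s -> 0 <= f s,
      {within nonneg_reals, continuous f},
      f 0 = 0 &
      forall s t : R, 0 <= s -> s < t -> f s < f t].

Definition class_Koo f : Prop :=
  class_K f /\ f s @[s --> +oo] --> +oo.

Definition class_L f : Prop :=
  [/\ forall t : R, 0 <= t -> 0 <= f t,
      {within nonneg_reals, continuous f},
      forall s t : R, 0 <= s -> s <= t -> f t <= f s &
      f t @[t --> +oo] --> 0].

Definition class_KL b : Prop :=
  (forall t : R, 0 <= t -> class_K (b ^~ t)) /\
  (forall s : R, 0 <= s -> class_L (b s)).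

(* The inverse of f restricted to [0, +oo[; it is meaningful at y only when
   inv_defined f y holds, and is an arbitrary value elsewhere. *)
Definition inv_nonneg f : R -> R := pinv nonneg_reals f.

Definition inv_defined f (y : R) : Prop := (f @` nonneg_reals) y.

End Comparison.

Section System.
Variable R : realType.

Definition euclid d (x : 'rV[R]_d) : R := Num.sqrt (\sum_(i < d) x 0 i ^+ 2).

(* A sequence of k vectors of R^d is the k x d matrix of its rows; the norm of
   the empty sequence is 0. *)
Definition seq_norm k d (u : 'M[R]_(k, d)) : R :=
  \big[Num.max/0]_(i < k) euclid (row i u).

Fixpoint state n g (f : 'rV[R]_n -> 'rV[R]_g -> 'rV[R]_n)
    (x0 : 'rV[R]_n) (w : nat -> 'rV[R]_g) (t : nat) : 'rV[R]_n :=
  if t is t'.+1 then f (state f x0 w t') (w t') else x0.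

Definition iIOSS n g p (f : 'rV[R]_n -> 'rV[R]_g -> 'rV[R]_n)
    (h : 'rV[R]_n -> 'rV[R]_p)
    (beta : R -> R -> R) (alpha1 alpha2 : R -> R) : Prop :=
  [/\ class_KL beta, class_K alpha1, class_K alpha2 &
      forall (x1 x2 : 'rV[R]_n) (w1 w2 : nat -> 'rV[R]_g) (t : nat),
        euclid (state f x1 w1 t - state f x2 w2 t) <=
          beta (euclid (x1 - x2)) t%:R
          + alpha1 (seq_norm (\matrix_(i < t) (w1 i - w2 i)))
          + alpha2 (seq_norm (\matrix_(i < t.+1)
                      (h (state f x1 w1 i) - h (state f x2 w2 i))))].

(* V t e omega nu is the cost at time t of the initial deviation e, the
   disturbances omega_{0:t-1} and the noises nu_{0:t}. *)
Definition cost_bounds n g p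
    (V : forall t : nat, 'rV[R]_n -> 'M[R]_(t, g) -> 'M[R]_(t.+1, p) -> R)
    (xbar0 : 'rV[R]_n) (Bx : set 'rV[R]_n)
    (Bw : forall t : nat, set 'M[R]_(t, g))
    (Bv : forall t : nat, set 'M[R]_(t.+1, p))
    (urho_x rho_x : R -> R -> R)
    (ugamma_w ugamma_v gamma_w gamma_v : R -> R) : Prop :=
  [/\ class_KL urho_x /\ class_KL rho_x,
      class_Koo ugamma_w /\ class_Koo ugamma_v,
      class_Koo gamma_w /\ class_Koo gamma_v &
      exists (V1 : nat -> 'rV[R]_n -> R)
             (V2 : forall t : nat, 'M[R]_(t, g) -> 'M[R]_(t.+1, p) -> R),
      [/\ forall t e omega nu, V t e omega nu = V1 t e + V2 t omega nu,
          forall t, continuous (V1 t),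
          forall t, continuous
            (fun z : 'M[R]_(t, g) * 'M[R]_(t.+1, p) => V2 t z.1 z.2) &
          forall t chi0 omega nu, Bx chi0 -> Bw t omega -> Bv t nu ->
            (urho_x (euclid (chi0 - xbar0)) t%:R <= V1 t (chi0 - xbar0)
               <= rho_x (euclid (chi0 - xbar0)) t%:R) /\
            (ugamma_w (seq_norm omega) + ugamma_v (seq_norm nu)
               <= V2 t omega nu
               <= gamma_w (seq_norm omega) + gamma_v (seq_norm nu))]].

End System.

Section Gains.
Variable R : realType.
Variables (beta urho_x rho_x bbeta_x : R -> R -> R).
Variables (alpha1 alpha2 ugamma_w ugamma_v gamma_w gamma_v : R -> R).
Variables (balpha_w balpha_v : R -> R).

Definition gain_inequality : Prop :=
  forall sx sw sv t : R, 0 <= sx -> 0 <= sw -> 0 <= sv -> 0 <= t ->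
    let c := rho_x sx t + gamma_w sw + gamma_v sv in
    inv_defined (urho_x ^~ t) c /\
    beta (sx + inv_nonneg (urho_x ^~ t) c) t
      <= bbeta_x sx t + balpha_w sw + balpha_v sv.

Definition beta_x (s t : R) : R :=
  bbeta_x s t + alpha1 (3 * inv_nonneg ugamma_w (3 * rho_x s t))
              + alpha2 (3 * inv_nonneg ugamma_v (3 * rho_x s t)).

Definition alpha_w (s : R) : R :=
  balpha_w s + alpha1 (3 * s + 3 * inv_nonneg ugamma_w (3 * gamma_w s))
             + alpha2 (3 * inv_nonneg ugamma_v (3 * gamma_w s)).

Definition alpha_v (s : R) : R :=
  balpha_v s + alpha1 (3 * inv_nonneg ugamma_w (3 * gamma_v s))
             + alpha2 (3 * s + 3 * inv_nonneg ugamma_v (3 * gamma_v s)).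

Definition s_bar (eta M0 Mw Mv : R) : R :=
  beta_x M0 0 + (1 - eta)^-1 * (alpha_w Mw + alpha_v Mv).

End Gains.

(* Main.v *)
Require Import Defs.
From HB Require Import structures.
From mathcomp Require Import all_boot all_order all_algebra.
From mathcomp Require Import all_classical all_reals all_analysis.
From mathcomp Require Import lra.
Set Implicit Arguments.
Unset Strict Implicit.
Unset Printing Implicit Defensive.
Import Order.TTheory GRing.Theory Num.Theory.
Import numFieldNormedType.Exports.
Local Open Scope classical_set_scope.
Local Open Scope ring_scope.

(* Write nu for the inverse of mu2, so that the inverse of urho_x at time t maps
   c to nu (c / phi2 t). For increasing functions F, F (a + b + c) is at most
   F (3 a) + F (3 b) + F (3 c). Applied to nu and then to mu1, this bounds the
   left-hand side of the gain inequality by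
     mu1 (3 sx + 3 nu (3 mu3 sx)) phi1 t
       + mu1 (3 nu (3 gamma_w sw / phi2 t)) phi1 t
       + mu1 (3 nu (3 gamma_v sv / phi2 t)) phi1 t.
   The first summand serves as bbeta_x, and the hypothesis on mu1 and mu2
   absorbs the other two into class K functions of sw and sv. Taking pi = id
   and t = 0 in that hypothesis also shows that mu2 is onto, so that nu is of
   class K and bbeta_x of class KL. With this bbeta_x, the condition imposed on
   T is literally the contraction to be proved. *)

Section ComparisonFunctions.
Variable R : realType.
Implicit Types (f g phi : R -> R) (s t c : R).

Lemma in_nonneg_reals s : nonneg_reals s <-> 0 <= s.
Proof. by rewrite /nonneg_reals /= in_itv /= andbT. Qed.

(** Continuity on the subspace becomes convergence along a [within] filter at each point, the form
    to which limit rules such as [cvgD] and [cvgM] apply. *)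
Lemma continuous_nonneg_realsP f :
  {within (@nonneg_reals R), continuous f} <->
  forall s, 0 <= s -> f t @[t --> within (@nonneg_reals R) (nbhs s)] --> f s.
Proof.
split=> [/subspace_continuousP fc s /in_nonneg_reals|fc]; first exact: fc.
by apply/subspace_continuousP => s /in_nonneg_reals; exact: fc.
Qed.

Lemma class_K_ge0 f s : class_K f -> 0 <= s -> 0 <= f s.
Proof. by case=> + _ _ _; exact. Qed.

Lemma class_K_ltW f s t : class_K f -> 0 <= s -> s <= t -> f s <= f t.
Proof.
case=> _ _ _ f_incr s0; rewrite le_eqVlt => /predU1P[->//|st].
exact/ltW/f_incr.
Qed.

Lemma class_K_gt0 f s : class_K f -> 0 < s -> 0 < f s.
Proof. by case=> _ _ f0 f_incr s0; rewrite -f0 f_incr. Qed.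

Lemma class_K_lt_reflect f s t : class_K f -> 0 <= t -> f s < f t -> s < t.
Proof.
move=> fK t0; apply: contraTT; rewrite -!leNgt => ts.
exact: class_K_ltW.
Qed.

Lemma class_K_inj f : class_K f -> {in @nonneg_reals R &, injective f}.
Proof.
case=> _ _ _ f_incr s t; rewrite !inE => /in_nonneg_reals s0.
move=> /in_nonneg_reals t0 fst; case: (ltgtP s t) => // st.
- by have := f_incr _ _ s0 st; rewrite fst ltxx.
- by have := f_incr _ _ t0 st; rewrite fst ltxx.
Qed.

Lemma class_K_id : class_K (@id R).
Proof.
by split=> //; apply/continuous_nonneg_realsP => s _; exact: cvg_within.
Qed.

Lemma class_K_comp f g : class_K f -> class_K g -> class_K (f \o g).
Proof.
move=> fK gK; have [_ /continuous_nonneg_realsP fc f0 f_incr] := fK.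
have [g_ge0 /continuous_nonneg_realsP gc g0 g_incr] := gK.
split=> [s s0||/=|s t s0 st /=].
- exact: class_K_ge0 fK (g_ge0 _ s0).
- apply/continuous_nonneg_realsP => s s0.
  (* Since [g] maps [0, +oo[ into itself, it carries the [within] filter at [s] to the one at [g s],
     where continuity of [f] applies. *)
  apply: cvg_comp (fc _ (g_ge0 _ s0)) => A /(gc _ s0) /=.
  rewrite !nbhs_simpl /within /=; apply: filterS => t gt Dt; apply: (gt Dt).
  exact/in_nonneg_reals/g_ge0/in_nonneg_reals.
- by rewrite g0.
- exact: f_incr (g_ge0 _ s0) (g_incr _ _ s0 st).
Qed.

Lemma class_KD f g : class_K f -> class_K g -> class_K (fun s => f s + g s).
Proof.
move=> [f_ge0 /continuous_nonneg_realsP fc f0 f_incr].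
move=> [g_ge0 /continuous_nonneg_realsP gc g0 g_incr].
split=> [s s0|||s t s0 st].
- by rewrite addr_ge0 ?f_ge0 ?g_ge0.
- by apply/continuous_nonneg_realsP => s s0; apply: cvgD; [exact: fc|exact: gc].
- by rewrite f0 g0 addr0.
- by rewrite ltrD ?f_incr ?g_incr.
Qed.

Lemma class_KZ c f : 0 < c -> class_K f -> class_K (fun s => c * f s).
Proof.
move=> c0 [f_ge0 /continuous_nonneg_realsP fc f0 f_incr].
split=> [s s0|||s t s0 st].
- exact: mulr_ge0 (ltW c0) (f_ge0 _ s0).
- apply/continuous_nonneg_realsP => s s0.
  by apply: cvgM; [exact: cvg_cst|exact: fc].
- by rewrite f0 mulr0.
- by rewrite ltr_pM2l ?f_incr.
Qed.

Lemma class_LZ c phi : 0 <= c -> class_L phi -> class_L (fun t => c * phi t).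
Proof.
move=> c0 [phi_ge0 /continuous_nonneg_realsP phic phi_decr phi0].
split=> [t t0||s t s0 st|].
- by rewrite mulr_ge0 ?phi_ge0.
- apply/continuous_nonneg_realsP => s s0.
  by apply: cvgM; [exact: cvg_cst|exact: phic].
- by rewrite ler_wpM2l ?phi_decr.
- by rewrite -(mulr0 c); apply: cvgM; first exact: cvg_cst.
Qed.

Lemma inv_nonneg_eq f s t : class_K f -> 0 <= s -> f s = t ->
  inv_nonneg f t = s.
Proof.
move=> fK /in_nonneg_reals s0 <-; rewrite /inv_nonneg pinvKV ?inE//.
exact: class_K_inj.
Qed.

Section Inverse.
Variable f : R -> R.
Hypothesis fK : class_K f.
(** A class K function may be bounded, so reaching every nonnegative value is a separate
    assumption. *)
Hypothesis f_surj : forall t, 0 <= t -> inv_defined f t.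

Lemma inv_nonneg_ge0 t : 0 <= t -> 0 <= inv_nonneg f t.
Proof.
move=> /f_surj[s /in_nonneg_reals s0 fst].
by rewrite (inv_nonneg_eq fK s0 fst).
Qed.

Lemma inv_nonnegK t : 0 <= t -> f (inv_nonneg f t) = t.
Proof.
move=> /f_surj[s /in_nonneg_reals s0 fst].
by rewrite (inv_nonneg_eq fK s0 fst).
Qed.

Lemma inv_nonneg_lt s t : 0 <= s -> s < t -> inv_nonneg f s < inv_nonneg f t.
Proof.
move=> s0 st; have t0 := ltW (le_lt_trans s0 st).
by apply: (class_K_lt_reflect fK); rewrite ?inv_nonneg_ge0 ?inv_nonnegK.
Qed.

(** Continuity comes from monotonicity: [t] near [s] lies between the values of [f] at
    [inv_nonneg f s - e] and [inv_nonneg f s + e], and [class_K_lt_reflect] turns this into bounds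
    on [inv_nonneg f t]. *)
Lemma class_K_inv_nonneg : class_K (inv_nonneg f).
Proof.
split; [exact: inv_nonneg_ge0| |by apply: inv_nonneg_eq => //; case: fK|
  exact: inv_nonneg_lt].
apply/continuous_nonneg_realsP => s s0; apply/cvgrPdist_lt => e e0 /=.
have gs0 := inv_nonneg_ge0 s0; have se : s < f (inv_nonneg f s + e).
  by rewrite -{1}(inv_nonnegK s0); case: fK => _ _ _; apply=> //; lra.
(* If [inv_nonneg f s < e], the left endpoint falls outside the domain of [f], and nonnegativity of
   the inverse gives the bound instead. *)
have lower : \forall t \near s, 0 <= t -> inv_nonneg f s - e < inv_nonneg f t.
  have [ge|ge] := ltP (inv_nonneg f s) e.
    by near=> t => /inv_nonneg_ge0; lra.
  have es : f (inv_nonneg f s - e) < s.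
    by rewrite -{2}(inv_nonnegK s0); case: fK => _ _ _; apply; lra.
  near=> t => t0; apply: (class_K_lt_reflect fK (inv_nonneg_ge0 t0)).
  by rewrite inv_nonnegK//; near: t; exact: lt_nbhsr.
near=> t; rewrite ltr_distlC; apply/andP.
have t0 : 0 <= t by apply/in_nonneg_reals; near: t; exact: near_withinT.
split; first by move: (t0); near: t; exact: cvg_within.
apply: (class_K_lt_reflect fK); first by lra.
rewrite inv_nonnegK//; near: t; apply: cvg_within; exact: lt_nbhsl.
Unshelve. all: by end_near. Qed.

End Inverse.

(** A class L function may vanish, but strict growth of [b] in its first argument forces
    [f 1 * phi t] to be positive. *)
Lemma class_KL_prod_gt0 f phi b t : class_KL b ->
  (forall s u, 0 <= s -> 0 <= u -> b s u = f s * phi u) ->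
  class_K f -> 0 <= t -> 0 < phi t.
Proof.
move=> [bK _] bE fK t0.
have := class_K_gt0 (bK _ t0) (@ltr01 R); rewrite bE//.
by rewrite pmulr_rgt0 //; apply: class_K_gt0.
Qed.

Lemma class_KL_prod f phi : class_K f -> class_L phi ->
  (forall t, 0 <= t -> 0 < phi t) -> class_KL (fun s t => f s * phi t).
Proof.
move=> fK phiL phi_gt0; split=> [t t0|s s0].
  under eq_fun do rewrite mulrC.
  exact: class_KZ (phi_gt0 _ t0) fK.
exact/class_LZ/phiL/class_K_ge0.
Qed.

(** The sum is at most three times its largest term, so one summand on the right already dominates;
    the other two are nonnegative. *)
Lemma class_KD3_le f a b c : class_K f -> 0 <= a -> 0 <= b -> 0 <= c ->
  f (a + b + c) <= f (3 * a) + f (3 * b) + f (3 * c).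
Proof.
move=> fK a0 b0 c0.
have fa : 0 <= f (3 * a) by rewrite class_K_ge0// mulr_ge0.
have fb : 0 <= f (3 * b) by rewrite class_K_ge0// mulr_ge0.
have fc : 0 <= f (3 * c) by rewrite class_K_ge0// mulr_ge0.
have s0 : 0 <= a + b + c by rewrite !addr_ge0.
have [ab|ba] := leP a b; have [ac|ca] := leP a c; have [bc|cb] := leP b c;
  by [ have : f (a + b + c) <= f (3 * a); [apply: class_K_ltW => //; lra|lra]
     | have : f (a + b + c) <= f (3 * b); [apply: class_K_ltW => //; lra|lra]
     | have : f (a + b + c) <= f (3 * c); [apply: class_K_ltW => //; lra|lra] ].
Qed.

Lemma class_K_gain f g s a b c : class_K f -> class_K g ->
  0 <= s -> 0 <= a -> 0 <= b -> 0 <= c ->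
  f (s + g (a + b + c))
    <= f (3 * s + 3 * g (3 * a)) + f (3 * g (3 * b)) + f (3 * g (3 * c)).
Proof.
move=> fK gK s0 a0 b0 c0; rewrite -mulrDr.
have g3_ge0 x : 0 <= x -> 0 <= g (3 * x).
  by move=> x0; rewrite class_K_ge0// mulr_ge0.
have abc0 : 0 <= g (a + b + c) by rewrite class_K_ge0// !addr_ge0.
(* Splitting [g] leaves four terms; [s + g (3 * a)] is kept as one summand when [f] is split in
   turn. *)
apply: (@le_trans _ _ (f (s + g (3 * a) + g (3 * b) + g (3 * c)))).
  by apply: class_K_ltW => //; [lra|have := class_KD3_le gK a0 b0 c0; lra].
by apply: class_KD3_le; rewrite ?addr_ge0 ?g3_ge0.
Qed.

End ComparisonFunctions.

Theorem lemma7 (R : realType) (n g p : nat)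
    (f : 'rV[R]_n -> 'rV[R]_g -> 'rV[R]_n) (h : 'rV[R]_n -> 'rV[R]_p)
    (f_cont : continuous (fun z : 'rV[R]_n * 'rV[R]_g => f z.1 z.2))
    (h_cont : continuous h)
    (beta : R -> R -> R) (alpha1 alpha2 : R -> R)
    (f_h_iIOSS : iIOSS f h beta alpha1 alpha2)
    (xbar0 : 'rV[R]_n) (Bx : set 'rV[R]_n)
    (Bw : forall t : nat, set 'M[R]_(t, g))
    (Bv : forall t : nat, set 'M[R]_(t.+1, p))
    (Bx_bounded : exists C : R, forall x : 'rV[R]_n, Bx x -> euclid x <= C)
    (Bw_bounded : forall t, exists C : R, forall u, Bw t u -> seq_norm u <= C)
    (Bv_bounded : forall t, exists C : R, forall u, Bv t u -> seq_norm u <= C)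
    (V : forall t : nat, 'rV[R]_n -> 'M[R]_(t, g) -> 'M[R]_(t.+1, p) -> R)
    (urho_x rho_x : R -> R -> R)
    (ugamma_w ugamma_v gamma_w gamma_v : R -> R)
    (V_bounds : cost_bounds V xbar0 Bx Bw Bv urho_x rho_x
                  ugamma_w ugamma_v gamma_w gamma_v)
    (mu1 mu2 mu3 phi1 phi2 : R -> R)
    (mu1_K : class_K mu1) (mu2_K : class_K mu2) (mu3_K : class_K mu3)
    (phi1_L : class_L phi1) (phi2_L : class_L phi2)
    (betaE : forall s t : R, 0 <= s -> 0 <= t -> beta s t = mu1 s * phi1 t)
    (urho_xE : forall s t : R, 0 <= s -> 0 <= t -> urho_x s t = mu2 s * phi2 t)
    (rho_xE : forall s t : R, 0 <= s -> 0 <= t -> rho_x s t = mu3 s * phi2 t)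
    (mu_phi : forall pi : R -> R, class_K pi ->
       exists pi' : R -> R, class_K pi' /\
         forall s t : R, 0 <= s -> 0 <= t ->
           inv_defined mu2 (pi s / phi2 t) /\
           mu1 (3 * inv_nonneg mu2 (pi s / phi2 t)) * phi1 t <= pi' s)
    (eta M0 Mw Mv : R) (eta_itv : 0 < eta < 1)
    (M0_ge0 : 0 <= M0) (Mw_ge0 : 0 <= Mw) (Mv_ge0 : 0 <= Mv) :
  exists (bbeta_x : R -> R -> R) (balpha_w balpha_v : R -> R),
    [/\ class_KL bbeta_x, class_K balpha_w, class_K balpha_v,
        gain_inequality beta urho_x rho_x bbeta_x gamma_w gamma_v
          balpha_w balpha_v &
        let sbar := s_bar rho_x bbeta_x alpha1 alpha2 ugamma_w ugamma_v
                      gamma_w gamma_v balpha_w balpha_v eta M0 Mw Mv in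
        forall T : nat,
          (forall s : R, 0 <= s <= sbar ->
             mu1 (3 * s + 3 * inv_nonneg mu2 (3 * mu3 s)) * phi1 T%:R
             + alpha1 (3 * inv_nonneg ugamma_w (3 * (mu3 s * phi2 T%:R)))
             + alpha2 (3 * inv_nonneg ugamma_v (3 * (mu3 s * phi2 T%:R)))
             <= eta * s) ->
          (forall s : R, 0 <= s <= sbar ->
             bbeta_x s T%:R
             + alpha1 (3 * inv_nonneg ugamma_w (3 * rho_x s T%:R))
             + alpha2 (3 * inv_nonneg ugamma_v (3 * rho_x s T%:R))
             <= eta * s)].
Proof.
have [beta_KL _ _ _] := f_h_iIOSS.
have [[urho_KL _] _ [[gw_K _] [gv_K _]] _] := V_bounds.
have phi1_gt0 t : 0 <= t -> 0 < phi1 t.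
  exact: class_KL_prod_gt0 beta_KL betaE mu1_K.
have phi2_gt0 t : 0 <= t -> 0 < phi2 t.
  exact: class_KL_prod_gt0 urho_KL urho_xE mu2_K.
have mu2_surj t : 0 <= t -> inv_defined mu2 t.
  (* The argument [t * phi2 0] at time 0 makes the quotient equal to [t], so the definedness clause
     is the claim. *)
  move=> t0; have [pi' [_ /(_ (t * phi2 0) 0)]] := mu_phi _ (@class_K_id R).
  rewrite mulr_ge0 ?(ltW (phi2_gt0 _ _))// mulfK ?gt_eqF ?phi2_gt0//.
  by case.
have mu2V_K := class_K_inv_nonneg mu2_K mu2_surj.
have three_gt0 : 0 < 3 :> R by [].
(* The factor 3 is the one that splitting the inverse of [mu2] puts in front of [gamma_w] and
   [gamma_v]. *)
have [piw [piw_K piwP]] := mu_phi _ (class_KZ three_gt0 gw_K).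
have [piv [piv_K pivP]] := mu_phi _ (class_KZ three_gt0 gv_K).
have gain_K : class_K (fun s => mu1 (3 * s + 3 * inv_nonneg mu2 (3 * mu3 s))).
  apply: (class_K_comp mu1_K); apply: class_KD.
    exact: class_KZ (@class_K_id R).
  apply: (class_KZ three_gt0); apply: (class_K_comp mu2V_K).
  exact: class_KZ.
exists (fun s t => mu1 (3 * s + 3 * inv_nonneg mu2 (3 * mu3 s)) * phi1 t),
  piw, piv; split => //.
- exact: class_KL_prod.
- move=> sx sw sv t sx0 sw0 sv0 t0 /=; rewrite rho_xE//.
  have phi2t := phi2_gt0 _ t0; have phi2t0 := ltW phi2t.
  have gw0 := class_K_ge0 gw_K sw0; have gv0 := class_K_ge0 gv_K sv0.
  have mu3s0 := class_K_ge0 mu3_K sx0.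
  set c := _ + _ + _; set z := inv_nonneg mu2 (c / phi2 t).
  (* The factor [phi2 t] shared by [rho_x] and [urho_x] cancels in the [sx] term, whose contribution
     then depends on [t] through [phi1] alone. *)
  have cE : c / phi2 t = mu3 sx + gamma_w sw / phi2 t + gamma_v sv / phi2 t.
    by rewrite /c !mulrDl mulfK ?gt_eqF.
  have c_phi2 : 0 <= c / phi2 t by rewrite cE !addr_ge0 ?divr_ge0.
  have z0 : 0 <= z by exact: inv_nonneg_ge0.
  have urho_z : urho_x z t = c.
    by rewrite urho_xE// inv_nonnegK// divfK ?gt_eqF.
  split; first by exists z => //; exact/in_nonneg_reals.
  rewrite (inv_nonneg_eq (urho_KL.1 _ t0) z0 urho_z) betaE ?addr_ge0//.
  have [_ piw_le] := piwP _ _ sw0 t0; have [_ piv_le] := pivP _ _ sv0 t0.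
  (* Once [phi1 t] is factored out, what remains is [class_K_gain] for [mu1] and the inverse of
     [mu2]. *)
  apply: le_trans (lerD (lerD (lexx _) piw_le) piv_le); rewrite -!mulrDl.
  rewrite ler_wpM2r ?(ltW (phi1_gt0 _ t0))// /z cE -!mulrA.
  by apply: class_K_gain; rewrite ?divr_ge0.
- move=> sbar T le_eta s /[dup] /le_eta le_s /andP[s0 _].
  by rewrite rho_xE.
Qed.
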